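(* For every interval graph $G$ there exists an interval graph $\tilde{G}$ such that $\tilde{G}$ contains $G$ as an induced subgraph and $\tilde{G}$ is the phylogeny graph $P(D)$ of some doubly partial order $D$.
   Context: All graphs and digraphs are finite and simple. For $x\in\mathbb{R}^2$ write $x=(x_1,x_2)$, and for $x,y\in\mathbb{R}^2$ write $x\prec y$ if $x_1<y_1$ and $x_2<y_2$. A digraph $D$ is a doubly partial order if there is a finite set $V\subseteq\mathbb{R}^2$ with $V(D)=V$ and $A(D)=\{(x,v)\mid v,x\in V,\ v\prec x\}$. For a vertex $x$, $N^+_D(x)=\{v\in V(D)\mid (x,v)\in A(D)\}$. The phylogeny graph $P(D)$ is the simple undirected graph with $V(P(D))=V(D)$ and $E(P(D))=\{xy\mid x\neq y,\ N^+_D(x)\cap N^+_D(y)\neq\emptyset\}\cup\{xy\mid (x,y)\in A(D)\}$. A graph $G$ is an interval graph if there is an assignment of real closed intervals $J(v)$ to the vertices $v$ such that for distinct $v,w$, $vw\in E(G)$ iff $J(v)\cap J(w)\neq\emptyset$. *)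

(* Defs.v *)
From HB Require Import structures.
From mathcomp Require Import all_boot all_order all_algebra finmap.
From mathcomp Require Import reals.

Set Implicit Arguments.
Unset Strict Implicit.
Unset Printing Implicit Defensive.

Import Order.TTheory GRing.Theory Num.Theory.

Local Open Scope ring_scope.

Record sgraph := SGraph {
  vertex :> finType;
  adj : rel vertex;
  adj_sym : symmetric adj;
  adj_irrefl : irreflexive adj
}.

Record digraph := Digraph {
  dvertex :> finType;
  arc : rel dvertex;
  arc_irrefl : irreflexive arc
}.

(* Containment is up to isomorphism: [G] is isomorphic to the subgraph of [H]
   induced by the image of [f]. *)
Definition contains_induced (H G : sgraph) : Prop :=
  exists f : G -> H,
    injective f /\ forall x y : G, adj (f x) (f y) = adj x y.

Definition closed_interval (R : realType) (I : interval R) : Prop :=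
  exists a b : R, a <= b /\ I = `[a, b].

Definition interval_graph (R : realType) (G : sgraph) : Prop :=
  exists J : G -> interval R,
    (forall v : G, closed_interval (J v)) /\
    (forall v w : G, v != w ->
       (adj v w <-> exists x : R, x \in J v /\ x \in J w)).

Definition out_nbhd (D : digraph) (x : D) : {set D} := [set v | arc x v].

Definition phylogeny_adj (D : digraph) : rel D := fun x y =>
  [|| (x != y) && (out_nbhd x :&: out_nbhd y != set0), arc x y | arc y x].

Lemma phylogeny_adj_sym (D : digraph) : symmetric (@phylogeny_adj D).
Proof.
by move=> x y; rewrite /phylogeny_adj eq_sym setIC; congr (_ || _); rewrite orbC.
Qed.

Lemma phylogeny_adj_irrefl (D : digraph) : irreflexive (@phylogeny_adj D).
Proof. by move=> x; rewrite /phylogeny_adj eqxx arc_irrefl. Qed.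

Definition phylogeny_graph (D : digraph) : sgraph :=
  SGraph (@phylogeny_adj_sym D) (@phylogeny_adj_irrefl D).

Definition prec (R : realType) (x y : R * R) : bool :=
  (x.1 < y.1) && (x.2 < y.2).

Definition dpo_arc (R : realType) (V : {fset R * R}) : rel V :=
  fun x v => prec (val v) (val x).

Lemma dpo_arc_irrefl (R : realType) (V : {fset R * R}) :
  irreflexive (@dpo_arc R V).
Proof. by move=> x; rewrite /dpo_arc /prec ltxx. Qed.

Definition dpo_digraph (R : realType) (V : {fset R * R}) : digraph :=
  Digraph (@dpo_arc_irrefl R V).

Definition doubly_partial_order (R : realType) (D : digraph) : Prop :=
  exists V : {fset R * R}, D = dpo_digraph V.

(* Main.v *)
Require Import Defs.
From mathcomp Require Import all_boot all_order all_algebra finmap.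
From mathcomp Require Import reals.
From mathcomp Require Import lra.

(** Represent [G] by intervals [[a v, b v]] and let [e v > 0] be pairwise
    distinct and so small that a left endpoint [a w] lies in the enlarged open
    interval [(a v - e v, b v + e v)] only if it lies in [[a v, b v]].  The
    points [(t, - t)] below [(b v + e v, e v - a v)] are exactly those with [t]
    in the enlarged interval.  Since two closed intervals meet iff the larger of
    their left endpoints lies in both, the antidiagonal points [(a v, - a v)]
    realise all the edges of [G] as common out-neighbours.  The phylogeny graph
    on all these points is represented by the intervals [[a v, b v]] together
    with the degenerate intervals [[a v, a v]]. *)

Set Implicit Arguments.
Unset Strict Implicit.
Unset Printing Implicit Defensive.

Import Order.TTheory GRing.Theory Num.Theory.

Local Open Scope ring_scope.

Lemma pos_lower_bound (R : realType) (I : finType) (F : I -> R) :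
  exists2 d : R, 0 < d & forall i, 0 < F i -> d <= F i.
Proof.
exists (\big[Num.min/1]_(i | 0 < F i) F i).
  by apply: lt_bigmin => //; exact: ltr01.
by move=> i Fi; apply: bigmin_le_cond.
Qed.

Lemma closed_intervals_meet (R : realType) (a b c d : R) :
  a <= b -> c <= d ->
  (exists x, x \in `[a, b] /\ x \in `[c, d]) <-> (a <= d) && (c <= b).
Proof.
move=> ab cd; split=> [[x] | /andP[ad cb]].
  rewrite !in_itv /= => -[/andP[? ?] /andP[? ?]].
  by apply/andP; split; lra.
exists (Num.max a c); rewrite !in_itv /=.
by case: (leP a c) => ac; split; apply/andP; split; lra.
Qed.

Lemma interval_graph_endpoints (R : realType) (G : sgraph) :
  interval_graph R G ->
  exists a b : G -> R, (forall v, a v <= b v) /\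
    forall v w, v != w -> adj v w = (a v <= b w) && (a w <= b v).
Proof.
move=> [J [/fin_all_exists[a /fin_all_exists[b Jab]] Jadj]].
exists a, b; split=> [v | v w vw]; first by case: (Jab v).
have [[ab Jv] [cd Jw]] := (Jab v, Jab w).
have := closed_intervals_meet ab cd; rewrite -Jv -Jw => meet.
by apply/idP/idP => [/(Jadj _ _ vw)/meet | /meet/(Jadj _ _ vw)].
Qed.

Lemma interval_enlargement (R : realType) (G : finType) (a b : G -> R) :
  exists e : G -> R, [/\ injective e, forall v, 0 < e v &
    forall v w, a v - e v < a w -> a w < b v + e v -> a v <= a w <= b v].
Proof.
have [d d0 dP] := pos_lower_bound (fun p : G * G => a p.1 - a p.2).
have [c c0 cP] := pos_lower_bound (fun p : G * G => a p.1 - b p.2).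
pose r (v : G) : R := (enum_rank v).+1%:R^-1.
have r0 v : 0 < r v by rewrite invr_gt0 ltr0Sn.
have r1 v : r v <= 1 by rewrite invf_le1 ?ltr0Sn // ler1n.
have m0 : 0 < Num.min c d by rewrite lt_min c0.
have ec v : Num.min c d * r v <= c.
  apply: (@le_trans _ _ (Num.min c d)); last by rewrite ge_min lexx.
  by rewrite ger_pMr.
have ed v : Num.min c d * r v <= d.
  apply: (@le_trans _ _ (Num.min c d)); last by rewrite ge_min lexx orbT.
  by rewrite ger_pMr.
exists (fun v => Num.min c d * r v); split.
- move=> v w /(mulfI (lt0r_neq0 m0))/invr_inj/eqP.
  by rewrite eqr_nat eqSS => /eqP/val_inj/enum_rank_inj.
- by move=> v; apply: mulr_gt0.
- move=> v w h1 h2; apply/andP; split; rewrite leNgt; apply/negP => h.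
    by have := dP (v, w); rewrite /= subr_gt0 => /(_ h); have := ed v; lra.
  by have := cP (w, v); rewrite /= subr_gt0 => /(_ h); have := ec v; lra.
Qed.

Section Construction.

Variables (R : realType) (G : finType) (a b e : G -> R).
Hypothesis ab : forall v, a v <= b v.
Hypothesis e_inj : injective e.
Hypothesis e_gt0 : forall v, 0 < e v.
Hypothesis e_small :
  forall v w, a v - e v < a w -> a w < b v + e v -> a v <= a w <= b v.

Let P (v : G) : R * R := (b v + e v, e v - a v).
Let Q (v : G) : R * R := (a v, - a v).

Definition dpo_points : {fset R * R} :=
  ([fset P v | v in G] `|` [fset Q v | v in G])%fset.

Lemma P_in v : P v \in dpo_points.
Proof. by rewrite in_fsetU in_imfset. Qed.

Lemma Q_in v : Q v \in dpo_points.
Proof. by rewrite in_fsetU [X in _ || X]in_imfset ?orbT. Qed.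

Definition vertex_point v : dpo_points := [` P_in v]%fset.
Definition endpoint_point v : dpo_points := [` Q_in v]%fset.

Variant dpo_points_spec : dpo_points -> Prop :=
| IsVertexPoint v : dpo_points_spec (vertex_point v)
| IsEndpointPoint v : dpo_points_spec (endpoint_point v).

Lemma dpo_pointsP p : dpo_points_spec p.
Proof.
have := valP p; rewrite in_fsetU => /orP[] /imfsetP[v _ pv].
  by rewrite (_ : p = vertex_point v); [constructor | exact: val_inj].
by rewrite (_ : p = endpoint_point v); [constructor | exact: val_inj].
Qed.

Lemma vertex_point_inj : injective vertex_point.
Proof.
move=> v w /(congr1 val); rewrite /= /P => -[h1 h2].
have [[[ev ew] av] aw] := (e_gt0 v, e_gt0 w, ab v, ab w).
have /andP[h3 _] : a v <= a w <= b v by apply: e_small; lra.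
have /andP[h4 _] : a w <= a v <= b w by apply: e_small; lra.
by apply: e_inj; lra.
Qed.

Lemma vertex_neq_endpoint v w : vertex_point v != endpoint_point w.
Proof.
apply/eqP => /(congr1 val); rewrite /= /P /Q => -[h1 h2].
by have := e_gt0 v; have := ab v; lra.
Qed.

Let D := dpo_digraph dpo_points.

Lemma arc_endpoint (v : G) (p : D) : @Defs.arc D (endpoint_point v) p = false.
Proof.
apply/negP; rewrite /= /dpo_arc /prec.
case: (dpo_pointsP p) => w /andP[] /=; last by lra.
by have := e_gt0 w; have := ab w; lra.
Qed.

Lemma arc_vertex_endpoint v w :
  @Defs.arc D (vertex_point v) (endpoint_point w) = (a v <= a w <= b v).
Proof.
rewrite /= /dpo_arc /prec /=; have ev := e_gt0 v.
apply/andP/idP => [[h1 h2] | /andP[h1 h2]]; last by split; lra.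
by apply: e_small; lra.
Qed.

Lemma arc_vertex_vertex v w :
  @Defs.arc D (vertex_point v) (vertex_point w) -> a v <= a w <= b v.
Proof.
rewrite /= /dpo_arc /prec /= => /andP[h1 h2].
by have := e_gt0 w; have := ab w => ? ?; apply: e_small; lra.
Qed.

Lemma out_nbhd_endpoint v : @out_nbhd D (endpoint_point v) = set0.
Proof. by apply/setP => p; rewrite !inE arc_endpoint. Qed.

Lemma phylogeny_adj_endpoints v w :
  @phylogeny_adj D (endpoint_point v) (endpoint_point w) = false.
Proof.
by rewrite /phylogeny_adj out_nbhd_endpoint set0I eqxx andbF !arc_endpoint.
Qed.

Lemma phylogeny_adj_vertex_endpoint v w :
  @phylogeny_adj D (vertex_point v) (endpoint_point w) = (a v <= a w <= b v).
Proof.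
rewrite /phylogeny_adj out_nbhd_endpoint setI0 eqxx andbF arc_endpoint orbF.
exact: arc_vertex_endpoint.
Qed.

Lemma phylogeny_adj_vertices v w : v != w ->
  @phylogeny_adj D (vertex_point v) (vertex_point w) =
  (a v <= b w) && (a w <= b v).
Proof.
move=> vw; have [av aw] := (ab v, ab w); apply/idP/idP => [/or3P[] | /andP[h1 h2]].
- case/andP=> _ /set0Pn[p]; rewrite !inE; case: (dpo_pointsP p) => u.
    case/andP=> /arc_vertex_vertex/andP[? ?] /arc_vertex_vertex/andP[? ?].
    by apply/andP; split; lra.
  rewrite !arc_vertex_endpoint => /andP[/andP[? ?] /andP[? ?]].
  by apply/andP; split; lra.
- by move/arc_vertex_vertex/andP=> [? ?]; apply/andP; split; lra.
- by move/arc_vertex_vertex/andP=> [? ?]; apply/andP; split; lra.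
apply/or3P/Or31; rewrite (inj_eq vertex_point_inj) vw /=.
apply/set0Pn; exists (endpoint_point (if a v <= a w then w else v)).
rewrite !inE !arc_vertex_endpoint.
by case: (leP (a v) (a w)) => ?; apply/andP; split; apply/andP; split; lra.
Qed.

Definition point_interval (p : dpo_points) : interval R :=
  if [pick v | p == vertex_point v] is Some v then `[a v, b v]
  else `[(val p).1, (val p).1].

Lemma point_interval_vertex v : point_interval (vertex_point v) = `[a v, b v].
Proof.
rewrite /point_interval; case: pickP => [w /eqP/vertex_point_inj-> // | /(_ v)].
by rewrite eqxx.
Qed.

Lemma point_interval_endpoint v :
  point_interval (endpoint_point v) = `[a v, a v].
Proof.
rewrite /point_interval; case: pickP => [w | //].
by rewrite eq_sym (negPf (vertex_neq_endpoint _ _)).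
Qed.

Lemma dpo_points_interval_graph : interval_graph R (phylogeny_graph D).
Proof.
exists point_interval; split=> [p | p q].
  case: (dpo_pointsP p) => v.
    by rewrite point_interval_vertex; exists (a v), (b v).
  by rewrite point_interval_endpoint; exists (a v), (a v).
rewrite /adj /=; case: (dpo_pointsP p) => v; case: (dpo_pointsP q) => w vw;
  rewrite ?point_interval_vertex ?point_interval_endpoint;
  rewrite closed_intervals_meet //.
- by rewrite phylogeny_adj_vertices //; apply: contraNneq vw => ->.
- by rewrite phylogeny_adj_vertex_endpoint.
- by rewrite phylogeny_adj_sym phylogeny_adj_vertex_endpoint andbC.
rewrite phylogeny_adj_endpoints -eq_le; split=> // /eqP avw.
by case/eqP: vw; apply: val_inj; rewrite /= /Q avw.
Qed.

End Construction.

Theorem theorem2p3 (R : realType) (G : sgraph) (hG : interval_graph R G) :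
  exists G' : sgraph,
    interval_graph R G' /\ contains_induced G' G /\
    exists D : digraph, doubly_partial_order R D /\ G' = phylogeny_graph D.
Proof.
have [a [b [ab adjE]]] := interval_graph_endpoints hG.
have [e [e_inj e_gt0 e_small]] := interval_enlargement a b.
exists (phylogeny_graph (dpo_digraph (dpo_points a b e))).
split; first exact: dpo_points_interval_graph.
split; last first.
  by exists (dpo_digraph (dpo_points a b e)); split=> //; exists (dpo_points a b e).
exists (vertex_point a b e); split; first exact: vertex_point_inj.
move=> v w; have [-> | vw] := eqVneq v w; first by rewrite !adj_irrefl.
by rewrite adjE //= phylogeny_adj_vertices.
Qed.
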